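(* Let $Y$ be either $\mathbb{H}^Q$ with $3\le Q\le7$, or $\mathbb{G}^{Q,q}$ with $q\ge3$, $q<Q\le Q(q)$ (the transient cases). Suppose that $$\lim_n\frac{\|v_n\|^2}{|\Lambda_n|}=0,$$ where $v_n$ is the Perron--Frobenius eigenvector of $A_{\Lambda_n}$ normalized to $1$ at the root $0$. If the sequence of finite volume chemical potentials $\mu_n<\|A_Y\|-\|A_{\Lambda_n}\|$, $\mu_n\to0$, satisfies $$\frac1{|\Lambda_n|\big(\|A_Y\|-\|A_{\Lambda_n}\|-\mu_n\big)}\to c$$ for some $c>0$, then for the finite volume Gibbs states $\omega_n$ with two-point function $\omega_n(a^\dagger(u_1)a(u_2))=\langle(e^{H_n-\mu_n\mathbf{1}_n}-\mathbf{1}_n)^{-1}u_1,u_2\rangle$ one has $$\lim_n\omega_n(a^\dagger(\delta_0)a(\delta_0))=+\infty .$$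
   Context: Graphs. $\mathbb{G}^Q$ is the homogeneous Cayley tree in which every vertex has degree $Q$, $d$ is its graph distance, $A_{\mathbb{G}^Q}$ its adjacency operator on $\ell^2(\mathbb{G}^Q)$, with norm $2\sqrt{Q-1}$. Given a subtree $S\subset\mathbb{G}^Q$ and a root $0\in S$, the perturbed graph $Y$ has the same vertices and an additional self-loop at each vertex of $S$, so $A_Y=A_{\mathbb{G}^Q}+P_{\ell^2(S)}$, where $P_{\ell^2(S)}$ is the orthogonal projection onto $\ell^2(S)$. Then $Y=\mathbb{G}^{Q,q}$ when $S$ is isomorphic to $\mathbb{G}^q$, where $Q(q)=\big[\big(2\sqrt{q-1}+1+\sqrt{4\sqrt{q-1}+1}\big)^2/4\big]+1$ ($[\cdot]$ = integer part); and $Y=\mathbb{H}^Q$ when $S$ is a half-line isomorphic to $\mathbb{N}$ with end vertex $0$. Finite volumes: $\Lambda_n$ is the ball of radius $n$ centred at $0$ (tree metric $d$), $P_n$ the orthogonal projection onto $\ell^2(\Lambda_n)$, $\mathbf{1}_n$ the identity of $\ell^2(\Lambda_n)$, $A_{\Lambda_n}=P_nA_YP_n$, $H=\|A_Y\|\mathbf{1}-A_Y$, $H_n=P_nHP_n=\|A_Y\|\mathbf{1}_n-A_{\Lambda_n}$. The vector $v_n$ has positive entries and satisfies $A_{\Lambda_n}v_n=\|A_{\Lambda_n}\|v_n$, $v_n(0)=1$. For $u_1,u_2\in\ell^2(\Lambda_n)$, $\omega_n(a^\dagger(u_1)a(u_2))$ is the number given by the formula in the claim (inverse temperature $1$). 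*)

(* Defs.v *)
From HB Require Import structures.
From mathcomp Require Import all_boot all_order all_algebra finmap.
From mathcomp Require Import complex.
From mathcomp Require Import all_classical all_reals all_analysis.

Set Implicit Arguments.
Unset Strict Implicit.
Unset Printing Implicit Defensive.

Import Order.TTheory GRing.Theory Num.Theory.
Import numFieldNormedType.Exports.
Import ComplexField.Normc.

Local Open Scope classical_set_scope.
Local Open Scope ring_scope.

(* Locally finite simple graphs, given by their neighbourhoods. *)
Record graph := Graph {
  vertex :> choiceType;
  nbh : vertex -> {fset vertex};
  nbh_sym : forall x y, (x \in nbh y) = (y \in nbh x);
  nbh_irr : forall x, x \notin nbh x
}.

Definition adj (G : graph) : rel G := [rel x y | y \in nbh x].

Definition graph_connected (G : graph) : Prop :=
  forall x y : G, exists2 p, path (@adj G) x p & last x p = y.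

Definition graph_acyclic (G : graph) : Prop :=
  forall c : seq G, (2 < size c)%N -> ~ ucycle (@adj G) c.

Definition homogeneous_tree (Q : nat) (G : graph) : Prop :=
  [/\ graph_connected G, graph_acyclic G & forall x : G, #|` nbh x| = Q].

Definition walk (G : graph) (x y : G) (n : nat) : bool :=
  `[< exists p, [/\ path (@adj G) x p, last x p = y & size p = n] >].

(* Length of a shortest walk; the value 0 for disconnected pairs is junk. *)
Definition dist (G : graph) (x y : G) : nat :=
  match pselect (exists n, walk x y n) with
  | left xy => ex_minn xy
  | right _ => 0
  end.

(* f is an isomorphism of K onto the subgraph of G induced on S; in a tree
   every connected subgraph is induced. *)
Definition isomorphism_onto (K G : graph) (f : K -> G) (S : set G) : Prop :=
  [/\ injective f, forall x y, adj (f x) (f y) = adj x y & range f = S].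

Definition N_nbh (n : nat) : {fset nat} :=
  (if n is m.+1 then [fset m; m.+2] else [fset 1%N])%fset.

Lemma N_nbhE (m n : nat) : (m \in N_nbh n) = (m == n.+1) || (n == m.+1).
Proof.
case: n => [|n]; first by rewrite /= inE orbF.
by rewrite !inE eqSS [n == m]eq_sym orbC.
Qed.

Lemma N_nbh_sym (m n : nat) : (m \in N_nbh n) = (n \in N_nbh m).
Proof. by rewrite !N_nbhE orbC. Qed.

Lemma N_nbh_irr (n : nat) : n \notin N_nbh n.
Proof. by rewrite N_nbhE orbb ltn_eqF. Qed.

Definition N_graph : graph := Graph N_nbh_sym N_nbh_irr.

Definition half_line (G : graph) (o : G) (S : set G) : Prop :=
  exists f : N_graph -> G, isomorphism_onto f S /\ f 0%N = o.

Definition homogeneous_subtree (q : nat) (G : graph) (S : set G) : Prop :=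
  exists (K : graph) (f : K -> G),
    homogeneous_tree q K /\ isomorphism_onto f S.

Definition Qbound (R : realType) (q : nat) : nat :=
  let s : R := Num.sqrt (q%:R - 1) in
  (Num.truncn ((2 * s + 1 + Num.sqrt (4 * s + 1)) ^+ 2 / 4)).+1.

Definition opnorm (R : realType) (E : Type) (dom : set E) (nrm : E -> R)
    (T : E -> E) : R :=
  sup [set nrm (T u) | u in dom `&` [set u | nrm u <= 1]].

Section InfiniteVolume.
Context {R : realType} {G : graph}.
Implicit Types (S : set G) (f : G -> R[i]).

Definition l2sum f : \bar R := (\esum_(x in setT) (normc (f x) ^+ 2)%:E)%E.

Definition l2 : set (G -> R[i]) := [set f | (l2sum f < +oo)%E].

Definition l2norm f : R := Num.sqrt (fine (l2sum f)).

Definition adj_op f : G -> R[i] := fun x => \sum_(y <- nbh x) f y.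

Definition proj S f : G -> R[i] := fun x => \1_S x * f x.

(* Y is G with a self-loop added at each vertex of S. *)
Definition A_Y S f : G -> R[i] := fun x => adj_op f x + proj S f x.

Definition norm_A_Y S : R := opnorm l2 l2norm (A_Y S).

Definition dirac_fun (x : G) : G -> R[i] := fun y => (y == x)%:R.

End InfiniteVolume.

(* Exponential series, summed entrywise. *)
Definition expmx (K : numFieldType) (n : nat) (A : 'M[K]_n) : 'M[K]_n :=
  \matrix_(i, j)
    lim ((\sum_(0 <= k < N) (k`!%:R^-1 *: A ^+ k) i j : K^o) @[N --> \oo]).

(* l2 of a finite set L of vertices is the space of column vectors indexed by
   the enumeration of L. *)
Section FiniteVolume.
Context {R : realType} {G : graph}.

Definition ball_fset (o : G) (n : nat) : {fset G} :=
  fset_set [set x | (dist o x <= n)%N].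

Section OnFiniteSet.
Variable L : {fset G}.

Definition vtx (i : 'I_#|{: L}|) : G := val (enum_val i).

Definition restr (f : G -> R[i]) : 'cV[R[i]]_#|{: L}| := \col_i f (vtx i).

Definition value_at (u : 'cV[R[i]]_#|{: L}|) (x : G) : R[i] :=
  if insub x is Some y then u (enum_rank (y : L)) 0 else 0.

Definition inner (u w : 'cV[R[i]]_#|{: L}|) : R[i] :=
  \sum_i u i 0 * (w i 0)^*.

Definition fnorm (u : 'cV[R[i]]_#|{: L}|) : R :=
  Num.sqrt (\sum_i normc (u i 0) ^+ 2).

(* Matrix of the compression of A_Y to l2(L). *)
Definition A_fin (S : set G) : 'M[R[i]]_#|{: L}| :=
  \matrix_(i, j) A_Y S (dirac_fun (vtx j)) (vtx i).

Definition norm_A_fin (S : set G) : R :=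
  opnorm setT fnorm (mulmx (A_fin S)).

Definition H_fin (S : set G) : 'M[R[i]]_#|{: L}| :=
  (norm_A_Y S)%:C%C%:M - A_fin S.

(* omega(a^dagger(u1) a(u2)) at inverse temperature 1 and chemical
   potential mu.  Convergence of this complex number to +oo is meant for the
   filter pinfty_nbhs R[i]: for every real M it is eventually real and > M. *)
Definition two_point (S : set G) (mu : R) (u1 u2 : 'cV[R[i]]_#|{: L}|) : R[i] :=
  inner (invmx (expmx (H_fin S - mu%:C%C%:M) - 1%:M) *m u1) u2.

End OnFiniteSet.
End FiniteVolume.

(* Perron-Frobenius eigenvector of A_fin L S, equal to 1 at o. *)
Definition PF_vector (R : realType) (G : graph) (L : {fset G}) (S : set G)
    (o : G) (v : 'cV[R[i]]_#|{: L}|) : Prop :=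
  [/\ forall i, 0 < v i 0,
      A_fin L S *m v = (norm_A_fin L S)%:C%C *: v
    & value_at v o = 1].

(* Main.v *)
(** The matrix A of A_{Lambda_n} is Hermitian, so the two-point function of
    delta_0 is a sum over its eigenvalues alpha of positive terms
    |<delta_0, psi>|^2 / (e^(|A_Y| - mu_n - alpha) - 1).  The terms of the
    eigenvalue |A| alone give, by Cauchy-Schwarz against v_n and since
    <delta_0, v_n> = 1, at least 1 / (|v_n|^2 (e^(e_n) - 1)) with
    e_n = |A_Y| - |A| - mu_n.  As |Lambda_n| e_n -> 1/c and
    1 <= |v_n|^2 = o(|Lambda_n|), both e_n and |v_n|^2 e_n tend to 0, hence the
    lower bound diverges. *)
Require Import Defs.
From mathcomp Require Import all_boot all_order all_algebra finmap.
From mathcomp Require Import complex.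
From mathcomp Require Import all_classical all_reals all_analysis.
From mathcomp Require Import spectral sesquilinear ring lra.

Set Implicit Arguments.
Unset Strict Implicit.
Unset Printing Implicit Defensive.

Import Order.TTheory GRing.Theory Num.Theory.
Import numFieldNormedType.Exports.
Import ComplexField.Normc.

Local Open Scope classical_set_scope.
Local Open Scope ring_scope.

(** * The adjacency matrix of a finite volume *)

Lemma adj_op_dirac (R : realType) (G : graph) (x y : G) :
  adj_op (dirac_fun (R := R) y) x = (y \in nbh x)%:R.
Proof.
rewrite /adj_op /dirac_fun; case: (boolP (y \in nbh x)) => xy.
  rewrite (perm_big _ (perm_to_rem xy)) big_cons eqxx big1_seq
    ?Monoid.mulm1// => z.
  by rewrite mem_rem_uniq ?fset_uniq// !inE => /and3P[_ /negbTE-> _].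
rewrite big1_seq// => z /andP[_ zx]; case: eqVneq => // zy.
by rewrite -zy zx in xy.
Qed.

(** The matrix is real, neighbourhood is a symmetric relation, and the self-loops contribute only on
    the diagonal. *)
Lemma A_fin_hermitian (R : realType) (G : graph) (L : {fset G}) (S : set G) :
  A_fin (R := R) L S \is hermsymmx.
Proof.
apply/realsym_hermsym.
  apply/is_hermitianmxP; rewrite expr0 scale1r map_mx_id//.
  apply/matrixP => i j; rewrite !mxE /A_Y !adj_op_dirac /Defs.proj /dirac_fun.
  rewrite nbh_sym; congr (_ + _); rewrite eq_sym; case: eqP => [->//|_].
  by rewrite !mulr0.
apply/mxOverP => i j; rewrite !mxE /A_Y adj_op_dirac /Defs.proj /dirac_fun.
by rewrite rpredD// ?realn// rpredM ?realn// indicE realn.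
Qed.

Lemma cvg_real_complex (R : realType) (f : nat -> R) (l : R) :
  f x @[x --> \oo] --> l ->
  ((f x)%:C%C : R[i]^o) @[x --> \oo] --> (l%:C%C : R[i]^o).
Proof.
move=> fl; apply/cvgrPdist_lt => e e0.
(* A positive element of [R[i]] is real, so the tolerance can be used in the real limit. *)
have /complex_realP[d de] := gtr0_real e0; subst e.
rewrite ltcR in e0; have /cvgrPdist_lt/(_ d e0) := fl.
apply: filterS => x; rewrite -rmorphB/= normc_def/= expr0n addr0 sqrtr_sqr.
by rewrite ltcR.
Qed.

(** * Functional calculus in an eigenbasis *)

Section Spectral.
Context {R : realType} {n : nat}.
Local Notation C := R[i].
Implicit Types (P A : 'M[C]_n) (a : 'I_n -> R) (u w : 'cV[C]_n).

(** For unitary [P] this is the general form of a Hermitian matrix; keeping the eigenvalues [a] in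
    [R] gives access to their order and to [expR]. *)
Definition conjdiag P a : 'M[C]_n :=
  invmx P *m diag_mx (\row_i (a i)%:C%C) *m P.

Lemma hermitian_conjdiag A : A \is hermsymmx ->
  exists2 P, P \is unitarymx & exists a, A = conjdiag P a.
Proof.
move=> Ah; exists (spectralmx A); first exact: spectral_unitarymx.
exists (fun i => complex.Re (spectral_diag A 0 i)).
have -> : conjdiag (spectralmx A) (fun i => complex.Re (spectral_diag A 0 i)) =
    invmx (spectralmx A) *m diag_mx (spectral_diag A) *m spectralmx A.
  rewrite /conjdiag (_ : (\row_i _) = spectral_diag A)//; apply/rowP => i.
  rewrite mxE RRe_real//; exact: (mxOverP (hermitian_spectral_diag_real Ah)).
exact/orthomx_spectralP/hermitian_normalmx.
Qed.

Lemma unitary_inner P u w : P \is unitarymx ->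
  \sum_i (P *m u) i 0 * ((P *m w) i 0)^* = \sum_i u i 0 * (w i 0)^*.
Proof.
move=> Pu.
have E (x y : 'cV[C]_n) :
    \sum_i x i 0 * (y i 0)^* = ((map_mx Num.conj y^T) *m x) 0 0.
  by rewrite mxE; apply: eq_bigr => i _; rewrite !mxE mulrC.
rewrite !E trmx_mul map_mxM -mulmxA (mulmxA _ P).
have -> : map_mx Num.conj P^T *m P = 1%:M.
  by rewrite -invmx_unitary// mulVmx// unitarymx_unit.
by rewrite mul1mx.
Qed.

Lemma unitary_norm P u : P \is unitarymx ->
  \sum_i `|(P *m u) i 0| ^+ 2 = \sum_i `|u i 0| ^+ 2.
Proof.
move=> Pu; under eq_bigr do rewrite normCK.
by rewrite unitary_inner//; apply: eq_bigr => i _; rewrite normCK.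
Qed.

Lemma conjdiagE P a u i : P \in unitmx ->
  (P *m (conjdiag P a *m u)) i 0 = (a i)%:C%C * (P *m u) i 0.
Proof.
move=> Pu; rewrite /conjdiag !mulmxA mulmxV// mul1mx -mulmxA.
by rewrite mul_diag_mx !mxE.
Qed.

Lemma conjdiagM P a b : P \in unitmx ->
  conjdiag P a *m conjdiag P b = conjdiag P (fun i => a i * b i).
Proof.
move=> Pu; rewrite /conjdiag !mulmxA (mulmxK Pu).
rewrite -(mulmxA _ (diag_mx _) (diag_mx _)) mulmx_diag.
apply: (congr1 (fun d => invmx P *m diag_mx d *m P)); apply/rowP => i.
by rewrite !mxE rmorphM.
Qed.

Lemma conjdiagB P a b :
  conjdiag P a - conjdiag P b = conjdiag P (fun i => a i - b i).
Proof.
rewrite /conjdiag -mulmxBl -mulmxBr.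
apply: (congr1 (fun D => invmx P *m D *m P)); apply/matrixP => i j.
by rewrite !mxE -mulrnBl rmorphB.
Qed.

Lemma conjdiag_const P (x : R) : P \in unitmx ->
  conjdiag P (fun=> x) = (x%:C%C)%:M.
Proof.
move=> Pu; rewrite /conjdiag (_ : diag_mx _ = (x%:C%C)%:M).
  by rewrite mul_mx_scalar -scalemxAl mulVmx// scalemx1.
by apply/matrixP => i j; rewrite !mxE.
Qed.

Lemma conjdiagX P a k : P \in unitmx ->
  conjdiag P a ^+ k = conjdiag P (fun i => a i ^+ k).
Proof.
move=> Pu; elim: k => [|k IH]; first by rewrite conjdiag_const.
rewrite exprS IH; have -> : (fun i => a i ^+ k.+1) = (fun i => a i * a i ^+ k).
  by apply/funext => i; rewrite exprS.
exact: conjdiagM.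
Qed.

Lemma conjdiag_inv P a : P \in unitmx -> (forall i, a i != 0) ->
  invmx (conjdiag P a) = conjdiag P (fun i => (a i)^-1).
Proof.
move=> Pu a0; have aV : conjdiag P a *m conjdiag P (fun i => (a i)^-1) = 1%:M.
  rewrite (conjdiagM _ _ Pu) -[RHS](conjdiag_const 1 Pu).
  by apply: (congr1 (conjdiag P)); apply/funext => i; rewrite mulfV.
have [aU _] := mulmx1_unit aV.
by apply: (can_inj (mulKmx aU)); rewrite mulmxV.
Qed.

Lemma conjdiag_entry P a i j :
  conjdiag P a i j = \sum_l invmx P i l * P l j * (a l)%:C%C.
Proof.
rewrite /conjdiag mxE; apply: eq_bigr => l _.
by rewrite mul_mx_diag !mxE mulrAC.
Qed.

(** Each entry is a finite linear combination of the eigenvalues, with coefficients depending on [P]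
    only, so the entrywise matrix series reduces to finitely many scalar exponential series. *)
Lemma expmx_conjdiag P a : P \in unitmx ->
  expmx (conjdiag P a) = conjdiag P (fun i => expR (a i)).
Proof.
move=> Pu; apply/matrixP => i j; rewrite mxE conjdiag_entry.
apply/cvg_lim => //.
have E N : \sum_(0 <= k < N) (k`!%:R^-1 *: conjdiag P a ^+ k) i j =
    \sum_l invmx P i l * P l j * (series (exp_coeff (a l)) N)%:C%C.
  under eq_bigr => k _ do rewrite mxE conjdiagX// conjdiag_entry mulr_sumr.
  rewrite exchange_big/=; apply: eq_bigr => l _.
  rewrite /series/= rmorph_sum mulr_sumr; apply: eq_bigr => k _.
  rewrite /exp_coeff/= rmorphM fmorphV rmorph_nat mulrC.
  by rewrite [in RHS]mulrA.
rewrite (funext E); apply: cvg_big => [|l _]; first exact: add_continuous.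
apply: cvgMl_tmp; apply: cvg_real_complex; exact: is_cvg_series_exp_coeff.
Qed.

Lemma inner_conjdiag P a u : P \is unitarymx ->
  \sum_i (conjdiag P a *m u) i 0 * (u i 0)^* =
  \sum_i (a i)%:C%C * `|(P *m u) i 0| ^+ 2.
Proof.
move=> Pu; rewrite -(unitary_inner _ _ Pu); apply: eq_bigr => i _.
by rewrite conjdiagE ?unitarymx_unit// -mulrA normCK.
Qed.

Lemma conjdiag_eigen P a u (x : R) i : P \in unitmx ->
  conjdiag P a *m u = x%:C%C *: u -> (P *m u) i 0 != 0 -> a i = x.
Proof.
move=> Pu au ui0; apply: complexI; apply: (mulIf ui0).
by rewrite -conjdiagE// au -scalemxAr mxE.
Qed.

(* Expand |w_i - t y_i|^2 >= 0 with w = P u, y = P v and t = 1 / |v|^2, over the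
   indices where y_i <> 0. *)
Lemma conjdiag_eigen_lower_bound P a u w (x N : R) : P \is unitarymx ->
  (forall i, 0 <= a i) -> conjdiag P a *m w = x%:C%C *: w -> 0 <= x -> 0 < N ->
  \sum_i u i 0 * (w i 0)^* = 1 -> \sum_i `|w i 0| ^+ 2 = N%:C%C ->
  (x / N)%:C%C <= \sum_i (conjdiag P a *m u) i 0 * (u i 0)^*.
Proof.
move=> Pu a0 aw x0 N0 uw1 wN; rewrite inner_conjdiag//.
have PU := unitarymx_unit Pu.
pose t : C := (N^-1)%:C%C.
have tN : t * N%:C%C = 1 by rewrite -rmorphM mulVf// gt_eqF.
pose W i : C := (P *m u) i 0; pose Y i : C := (P *m w) i 0.
have WY : \sum_i W i * (Y i)^* = 1 by rewrite unitary_inner.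
have YW : \sum_i (W i)^* * Y i = 1.
  rewrite -[RHS]conjC1 -WY rmorph_sum; apply: eq_bigr => i _.
  by rewrite rmorphM/= conjCK.
have YY : \sum_i `|Y i| ^+ 2 = N%:C%C by rewrite unitary_norm.
(* The sum on the right is t + t - t^2 N, which is t because t N = 1. *)
have -> : (x / N)%:C%C = x%:C%C * (\sum_i
    (t * (W i * (Y i)^*) + t * ((W i)^* * Y i) - t ^+ 2 * `|Y i| ^+ 2)).
  rewrite sumrB big_split/= -!mulr_sumr WY YW YY expr2 -mulrA tN.
  by rewrite rmorphM mulr1 addrK.
rewrite mulr_sumr; apply: ler_sum => i _; rewrite -/(W i).
have [Y0|Y0] := eqVneq (Y i) 0.
  rewrite Y0 normr0 expr0n/= conjC0 !mulr0 addr0 subr0 mulr0.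
  by rewrite mulr_ge0 ?exprn_ge0// ler0c.
rewrite (conjdiag_eigen PU aw Y0) ler_wpM2l ?ler0c//.
rewrite -subr_ge0.
have -> : `|W i| ^+ 2 -
    (t * (W i * (Y i)^*) + t * ((W i)^* * Y i) - t ^+ 2 * `|Y i| ^+ 2) =
    `|W i - t * Y i| ^+ 2.
  have tR : t^* = t by apply/CrealP/complex_realP; exists N^-1.
  by rewrite !normCK rmorphB rmorphM /= tR; ring.
by rewrite exprn_ge0.
Qed.

End Spectral.

(** * Norms and point masses on a finite vertex set *)

Lemma fnormE (R : realType) (G : graph) (L : {fset G})
    (u : 'cV[R[i]]_#|{: L}|) :
  (fnorm u ^+ 2)%:C%C = \sum_i `|u i 0| ^+ 2.
Proof.
rewrite /fnorm sqr_sqrtr ?sumr_ge0// => [|i _]; last by rewrite sqr_ge0.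
by rewrite rmorph_sum; apply: eq_bigr => i _; rewrite rmorphXn.
Qed.

Lemma fnorm_ge0 (R : realType) (G : graph) (L : {fset G})
    (u : 'cV[R[i]]_#|{: L}|) : 0 <= fnorm u.
Proof. exact: sqrtr_ge0. Qed.

(** The unit eigenvector [invmx P *m delta_mx i 0] has an image of norm |a_i|. The supremum
    dominates this value once the set of norms is known to be bounded. *)
Lemma conjdiag_le_opnorm (R : realType) (G : graph) (L : {fset G})
    (P : 'M[R[i]]_#|{: L}|) a i : P \is unitarymx ->
  a i <= opnorm setT (@fnorm R G L) (mulmx (conjdiag P a)).
Proof.
move=> Pu; have PU := unitarymx_unit Pu.
have nE u : (fnorm (conjdiag P a *m u) ^+ 2)%:C%C =
    \sum_j ((a j) ^+ 2)%:C%C * `|(P *m u) j 0| ^+ 2.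
  rewrite fnormE -(unitary_norm _ Pu); apply: eq_bigr => j _.
  rewrite conjdiagE// normrM exprMn; congr (_ * _).
  by rewrite -normrX -rmorphXn/= ger0_norm// ler0c sqr_ge0.
(* A crude bound suffices: every |(P u)_j|^2 is at most |u|^2 <= 1. *)
pose D := \sum_j a j ^+ 2.
have D0 : 0 <= D by rewrite sumr_ge0// => j _; rewrite sqr_ge0.
apply: (@le_trans _ _ `|a i|); first exact: ler_norm.
apply: sup_upper_bound.
  split.
    exists (fnorm (conjdiag P a *m 0)); exists 0 => //; split => //=.
    by rewrite /fnorm big1 ?sqrtr0// => j _; rewrite mxE normc0 expr0n.
  exists (Num.sqrt D) => _ /= [u [_ u1] <-].
  rewrite -(ler_pXn2r (n := 2))// ?nnegrE ?fnorm_ge0 ?sqrtr_ge0//.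
  rewrite [in leRHS]sqr_sqrtr// -lecR nE rmorph_sum; apply: ler_sum => j _.
  rewrite -[leRHS]mulr1 ler_wpM2l ?ler0c ?sqr_ge0//.
  apply: (@le_trans _ _ (fnorm u ^+ 2)%:C%C).
    rewrite fnormE -(unitary_norm _ Pu) (bigD1 j)//= lerDl.
    by rewrite sumr_ge0// => k _; rewrite exprn_ge0.
  by rewrite -[leRHS]/((1 : R)%:C%C) lecR expr_le1// fnorm_ge0.
pose e : 'cV[R[i]]_#|{: L}| := invmx P *m delta_mx i 0.
have Pe j : (P *m e) j 0 = (j == i)%:R.
  by rewrite /e mulmxA mulmxV// mul1mx mxE eqxx andbT.
exists e.
  split => //=; rewrite -(ler_pXn2r (n := 2))// ?nnegrE ?fnorm_ge0//.
  rewrite expr1n -lecR fnormE -(unitary_norm _ Pu) (bigD1 i)//= big1.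
    by rewrite Pe eqxx normr1 expr1n addr0.
  by move=> j /negbTE ji; rewrite Pe ji normr0 expr0n.
apply/eqP; rewrite -(eqrXn2 (n := 2))// ?fnorm_ge0//; apply/eqP/complexI.
rewrite nE (bigD1 i)//= big1.
  by rewrite Pe eqxx normr1 expr1n addr0 mulr1 real_normK// num_real.
by move=> j /negbTE ji; rewrite Pe ji normr0 expr0n mulr0.
Qed.


Lemma inner_dirac (R : realType) (G : graph) (L : {fset G}) (o : G)
    (v : 'cV[R[i]]_#|{: L}|) :
  inner (restr L (dirac_fun o)) v = (value_at v o)^*.
Proof.
rewrite /inner /value_at; case: insubP => [y _ yo|oL].
  rewrite (bigD1 (enum_rank y))//= big1 => [|i iy].
    by rewrite mxE /vtx enum_rankK yo /dirac_fun eqxx mul1r addr0.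
  rewrite mxE /vtx /dirac_fun; case: eqP => [E|_]; last by rewrite mul0r.
  case/eqP: iy; rewrite -[LHS]enum_valK; congr enum_rank.
  by apply: val_inj; rewrite E.
(* Outside [L] the restricted point mass vanishes, in agreement with the default 0 of [value_at]. *)
rewrite conjC0 big1// => i _; rewrite mxE /vtx /dirac_fun.
by case: eqP => [E|_]; [rewrite -E (valP (enum_val i)) in oL | rewrite mul0r].
Qed.

(** The default of [value_at] is 0, so the value 1 forces [o] into [L], and the coordinate at [o]
    alone contributes 1. *)
Lemma fnorm_sqr_ge1 (R : realType) (G : graph) (L : {fset G}) (o : G)
    (v : 'cV[R[i]]_#|{: L}|) : value_at v o = 1 -> 1 <= fnorm v ^+ 2.
Proof.
rewrite /value_at; case: insubP => [y _ yo vy|_ /eqP]; last first.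
  by rewrite eq_sym oner_eq0.
rewrite -lecR fnormE (bigD1 (enum_rank y))//= vy normr1 expr1n lerDl.
by rewrite sumr_ge0// => i _; rewrite exprn_ge0.
Qed.

(** * The two-point function and its divergence *)

Lemma two_point_lower_bound (R : realType) (G : graph) (L : {fset G})
    (S : set G) (mu : R) (u v : 'cV[R[i]]_#|{: L}|)
    (e := norm_A_Y S - norm_A_fin L S - mu) :
  0 < e -> A_fin L S *m v = (norm_A_fin L S)%:C%C *: v ->
  0 < fnorm v -> inner u v = 1 ->
  ((expR e - 1)^-1 / fnorm v ^+ 2)%:C%C <= two_point S mu u u.
Proof.
move=> e0 Av v0 uv.
have [P Pu [a AE]] := hermitian_conjdiag (A_fin_hermitian R L S).
have PU := unitarymx_unit Pu.
have a_le i : a i <= norm_A_fin L S.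
  by rewrite /norm_A_fin AE; exact: conjdiag_le_opnorm.
(* The eigenvalues of H - mu; since [a i] is at most the norm, each is at least [e], which makes the
   Bose denominators positive. *)
pose b i := norm_A_Y S - a i - mu.
have b0 i : 0 < expR (b i) - 1.
  rewrite subr_gt0 expR_gt1 (lt_le_trans e0)// /e /b.
  by rewrite lerB// lerB.
have HE : invmx (expmx (H_fin L S - mu%:C%C%:M) - 1%:M) =
    conjdiag P (fun i => (expR (b i) - 1)^-1).
  rewrite /H_fin AE -(conjdiag_const (norm_A_Y S) PU) -(conjdiag_const mu PU).
  rewrite !conjdiagB (expmx_conjdiag _ PU) -[1%:M](conjdiag_const 1 PU).
  rewrite conjdiagB; apply: (conjdiag_inv PU) => i; exact: lt0r_neq0 (b0 i).
rewrite /two_point HE.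
apply: (@conjdiag_eigen_lower_bound _ _ P _ u v) => //.
- by move=> i; rewrite invr_ge0 ltW.
(* [v] stays an eigenvector after functional calculus: wherever its coordinate in the eigenbasis is
   nonzero, [a i] is the norm and [b i] is [e]. *)
- apply: (can_inj (mulKmx PU)); apply/matrixP => i j; rewrite ord1.
  rewrite conjdiagE// -scalemxAr [RHS]mxE.
  have [->|vi] := eqVneq ((P *m v) i 0) 0; first by rewrite !mulr0.
  suff -> : b i = e by [].
  have Pv : conjdiag P a *m v = (norm_A_fin L S)%:C%C *: v by rewrite -AE.
  by rewrite /b (conjdiag_eigen PU Pv vi).
- by rewrite invr_ge0 subr_ge0 ltW// expR_gt1.
- by rewrite exprn_gt0.
- by rewrite fnormE.
Qed.

(** From e^(-x) >= 1 - x one gets e^x - 1 <= x / (1 - x), and 1 - x >= 1/2. *)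
Lemma expR_sub1_le (R : realType) (x : R) :
  0 <= x -> x <= 2^-1 -> expR x - 1 <= 2 * x.
Proof.
move=> x0 x1; have := expR_ge1Dx (- x); rewrite expRN => h.
have := expR_gt0 x; set y := expR x in h * => y0.
have : (1 - x) * y <= 1.
  by rewrite -ler_pdivlMr// div1r.
nra.
Qed.

(** Here [N] is the volume, [V] the squared norm of the eigenvector and [e] the gap. The bound by
    c/4 makes [e] small enough to linearize the exponential; the bound by c/(4m) then gives 2 e V m
    < c N e / 2 < 1. *)
Lemma bose_factor_lower_bound (R : realType) (c m N e V : R) :
  0 < c -> 0 < m -> 1 <= V -> 0 < N -> 0 < e -> c / 2 < (N * e)^-1 ->
  V / N < c / 4 -> V / N < c / (4 * m) -> m < (expR e - 1)^-1 / V.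
Proof.
move=> c0 m0 V1 N0 e0 cNe VN1 VN2.
have Ne0 : 0 < N * e by rewrite mulr_gt0.
have V0 : 0 < V by lra.
have cNe2 : c * (N * e) < 2.
  by move: cNe; rewrite -[ltRHS]div1r ltr_pdivlMr// => h; lra.
have VN1' : 4 * V < c * N by move: VN1; rewrite ltr_pdivrMr// => h; lra.
have VN2' : 4 * (m * V) < c * N.
  move: VN2; rewrite ltr_pdivrMr// mulrAC ltr_pdivlMr ?mulr_gt0// => h; lra.
(* Since c N > 4 V >= 4 while c N e < 2. *)
have e1 : e <= 2^-1 by nra.
have E0 : 0 < expR e - 1 by rewrite subr_gt0 expR_gt1.
rewrite -invfM -[ltRHS]div1r ltr_pdivlMr ?mulr_gt0//.
have := expR_sub1_le (ltW e0) e1; set E := expR e - 1 => E2.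
have : E * V * m <= 2 * e * V * m by rewrite !ler_wpM2r// ltW.
have : e * (4 * (m * V)) < e * (c * N) by rewrite ltr_pM2l.
lra.
Qed.

Theorem proposition5p7 (R : realType) (Q : nat) (G : graph) (o : G)
    (S : set G) (v : forall n : nat, 'cV[R[i]]_#|{: ball_fset o n}|)
    (mu : nat -> R) (c : R) :
  homogeneous_tree Q G ->
  ((3 <= Q <= 7)%N /\ half_line o S) \/
  (exists q : nat, [/\ (3 <= q)%N, (q < Q)%N, (Q <= Qbound R q)%N,
                       S o & homogeneous_subtree q S]) ->
  (forall n, PF_vector S o (v n)) ->
  (fnorm (v n) ^+ 2 / #|` ball_fset o n|%:R) @[n --> \oo] --> (0 : R) ->
  (forall n, mu n < norm_A_Y S - norm_A_fin (ball_fset o n) S) ->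
  mu n @[n --> \oo] --> (0 : R) ->
  0 < c ->
  (#|` ball_fset o n|%:R *
     (norm_A_Y S - norm_A_fin (ball_fset o n) S - mu n))^-1
    @[n --> \oo] --> c ->
  two_point S (mu n) (restr (ball_fset o n) (dirac_fun o))
                     (restr (ball_fset o n) (dirac_fun o))
    @[n --> \oo] --> +oo.
Proof.
move=> _ _ PF VN0 mu_lt _ c0 cN B [M [/complex_realP[r ->] BM]].
(* The threshold is raised to a positive one, so that c/(4m) is a positive tolerance. *)
pose m := Num.max r 1.
have m0 : 0 < m by rewrite lt_max ltr01 orbT.
have c4m : 0 < c / (4 * m) by rewrite divr_gt0// mulr_gt0.
have c4 : 0 < c / 4 by rewrite divr_gt0.
have c2 : c / 2 < c by rewrite ltr_pdivrMr// ltr_pMr// ltr1n.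
suff : \forall n \near \oo, r%:C%C <
    two_point S (mu n) (restr (ball_fset o n) (dirac_fun o))
                       (restr (ball_fset o n) (dirac_fun o)).
  by apply: filterS => n; exact: BM.
near=> n.
have [_ Av v1] := PF n.
have V1 := fnorm_sqr_ge1 v1.
have e0 : 0 < norm_A_Y S - norm_A_fin (ball_fset o n) S - mu n.
  by rewrite subr_gt0.
have v0 : 0 < fnorm (v n).
  rewrite lt_neqAle fnorm_ge0 andbT; apply: contraTneq V1 => <-.
  by rewrite expr0n ler10.
have uv : inner (restr (ball_fset o n) (dirac_fun o)) (v n) = 1.
  by rewrite inner_dirac v1 conjC1.
apply: lt_le_trans (two_point_lower_bound e0 Av v0 uv).
rewrite ltcR (@le_lt_trans _ _ m)// ?le_max ?lexx//.
have cNe : c / 2 < (#|` ball_fset o n|%:R *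
     (norm_A_Y S - norm_A_fin (ball_fset o n) S - mu n))^-1.
  by near: n; exact: (cvgr_gt c).
apply: (@bose_factor_lower_bound _ c m #|` ball_fset o n|%:R) => //.
(* A zero volume would make the inverse in [cNe] equal to 0 by convention, contradicting c/2 > 0. *)
- rewrite lt_neqAle ler0n andbT; apply: contraTneq cNe => <-.
  by rewrite mul0r invr0 -leNgt divr_ge0// ltW.
- by near: n; exact: (cvgr_lt 0).
- by near: n; exact: (cvgr_lt 0).
Unshelve. all: by end_near.
Qed.
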